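(* Assume the setting in the context, that QEPmin is in the easy case, and let $v_*$ be the (unique) minimizer of CRQopt. Let $(\lambda_*,u_* )$ be the minimizer of LGopt, let $\theta_{\min}$ and $\theta_{\max}$ be the smallest and largest eigenvalues of $H$, and set $\kappa=\frac{\theta_{\max}-\lambda_*}{\theta_{\min}-\lambda_*}$ and $\Gamma_\kappa=\frac{\sqrt\kappa+1}{\sqrt\kappa-1}$. Then: (a) the sequence $\{h(v^{(k)})\}$ is nonincreasing; (b) for $k\le k_{\max}$, $0\le h(v^{(k)})-h(v_* )\le 16\gamma^2\|H-\lambda_* I\|_2\,[\Gamma_\kappa^k+\Gamma_\kappa^{-k}]^{-2}$, $\|v^{(k)}-v_*\|_2\le 4\gamma\sqrt\kappa\,[\Gamma_\kappa^k+\Gamma_\kappa^{-k}]^{-1}$, $|\mu^{(k)}-\lambda_*|\le 16\|H-\lambda_* I\|_2\,[\Gamma_\kappa^k+\Gamma_\kappa^{-k}]^{-2}+\frac{4}{\gamma}\|b_0\|_2\sqrt\kappa\,[\Gamma_\kappa^k+\Gamma_\kappa^{-k}]^{-1}$.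
   Context: Let $A\in\mathbb{R}^{n\times n}$ be symmetric, $C\in\mathbb{R}^{n\times m}$ ($m<n$) full column rank, $b\in\mathbb{R}^m$, $n_0=C(C^{\top}C)^{-1}b$ with $\|n_0\|<1$, $\gamma=\sqrt{1-\|n_0\|^2}$, $P=I-C(C^{\top}C)^{-1}C^{\top}$ (orthogonal projector onto $\mathcal N(C^{\top})$), $b_0=PAn_0\neq0$. Let $h(v)=v^{\top}Av$. CRQopt: minimize $h(v)$ subject to $v^{\top}v=1$, $C^{\top}v=b$. LGopt: minimize $\lambda$ over $(\lambda,u)$ with $(PAP-\lambda I)u=-b_0$, $\|u\|=\gamma$, $u\in\mathcal N(C^{\top})$. QEPmin: minimize $\lambda$ over $(\lambda,z)$ with $\lambda\in\mathbb{R}$, $0\ne z\in\mathcal N(C^{\top})$, $(PAP-\lambda I)^2z=\gamma^{-2}b_0b_0^{\top}z$. QEPmin is in the hard case if it has a minimizer $(\lambda_*,z_* )$ with $b_0^{\top}z_*=0$, and in the easy case otherwise. Let $S_1\in\mathbb{R}^{n\times(n-m)}$ have orthonormal columns spanning $\mathcal N(C^{\top})$ and $H=S_1^{\top}AS_1$. Lanczos process: with $M=PAP$, $q_0=0$, $\beta_1=\|b_0\|$, $q_1=b_0/\|b_0\|$, for $j=1,2,\dots$: $\alpha_j=q_j^{\top}Mq_j$, $\widehat q_{j+1}=Mq_j-\alpha_jq_j-\beta_jq_{j-1}$, $\beta_{j+1}=\|\widehat q_{j+1}\|$, and if $\beta_{j+1}>0$, $q_{j+1}=\widehat q_{j+1}/\beta_{j+1}$.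 $k_{\max}$ is the smallest $k$ with $\beta_{k+1}=0$. For $k\le k_{\max}$, $Q_k=[q_1,\dots,q_k]$ (orthonormal basis of the Krylov space $\mathcal K_k(PAP,b_0)=\operatorname{span}\{b_0,PAPb_0,\dots,(PAP)^{k-1}b_0\}$) and $T_k=Q_k^{\top}PAPQ_k$ is the symmetric tridiagonal matrix with diagonal $\alpha_1,\dots,\alpha_k$ and off-diagonal $\beta_2,\dots,\beta_k$. rLGopt: minimize $\lambda$ over $(\lambda,x)\in\mathbb{R}\times\mathbb{R}^k$ with $(T_k-\lambda I)x=-\|b_0\|e_1$, $\|x\|=\gamma$; $(\mu^{(k)},x^{(k)})$ denotes its minimizer and $v^{(k)}=n_0+Q_kx^{(k)}$. *)

(* Defs.v *)
From HB Require Import structures.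
From mathcomp Require Import all_boot all_order all_algebra.
From mathcomp Require Import boolp classical_sets reals.
Set Implicit Arguments.
Unset Strict Implicit.
Unset Printing Implicit Defensive.
Import Order.TTheory GRing.Theory Num.Theory.
Local Open Scope ring_scope.

Section Defs.
Variable R : realType.

Definition vnorm (p : nat) (x : 'cV[R]_p) : R :=
  Num.sqrt (\sum_(i < p) x i 0 ^+ 2).

Definition opnorm2 (p q : nat) (M : 'M[R]_(p, q)) : R :=
  sup [set vnorm (M *m x) | x in [set x : 'cV[R]_q | vnorm x = 1]].

Definition hq (n : nat) (A : 'M[R]_n) (v : 'cV[R]_n) : R :=
  (v^T *m A *m v) 0 0.

Definition n0v (n m : nat) (C : 'M[R]_(n, m)) (b : 'cV[R]_m) : 'cV[R]_n :=
  C *m invmx (C^T *m C) *m b.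

Definition gammav (n m : nat) (C : 'M[R]_(n, m)) (b : 'cV[R]_m) : R :=
  Num.sqrt (1 - vnorm (n0v C b) ^+ 2).

Definition Pproj (n m : nat) (C : 'M[R]_(n, m)) : 'M[R]_n :=
  1%:M - C *m invmx (C^T *m C) *m C^T.

Definition b0v (n m : nat) (A : 'M[R]_n) (C : 'M[R]_(n, m)) (b : 'cV[R]_m)
  : 'cV[R]_n := Pproj C *m A *m n0v C b.

Definition PAP (n m : nat) (A : 'M[R]_n) (C : 'M[R]_(n, m)) : 'M[R]_n :=
  Pproj C *m A *m Pproj C.

Definition CRQ_feasible (n m : nat) (C : 'M[R]_(n, m)) (b : 'cV[R]_m)
  (v : 'cV[R]_n) : Prop := v^T *m v = 1%:M /\ C^T *m v = b.
Definition CRQ_minimizer (n m : nat) (A : 'M[R]_n) (C : 'M[R]_(n, m))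
  (b : 'cV[R]_m) (v : 'cV[R]_n) : Prop :=
  CRQ_feasible C b v /\ forall w, CRQ_feasible C b w -> hq A v <= hq A w.

Definition LG_feasible (n m : nat) (A : 'M[R]_n) (C : 'M[R]_(n, m))
  (b : 'cV[R]_m) (lam : R) (u : 'cV[R]_n) : Prop :=
  (PAP A C - lam%:M) *m u = - b0v A C b /\ vnorm u = gammav C b
  /\ C^T *m u = 0.
Definition LG_minimizer (n m : nat) (A : 'M[R]_n) (C : 'M[R]_(n, m))
  (b : 'cV[R]_m) (lam : R) (u : 'cV[R]_n) : Prop :=
  LG_feasible A C b lam u /\
  forall lam' u', LG_feasible A C b lam' u' -> lam <= lam'.

Definition QEP_feasible (n m : nat) (A : 'M[R]_n) (C : 'M[R]_(n, m))
  (b : 'cV[R]_m) (lam : R) (z : 'cV[R]_n) : Prop :=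
  z != 0 /\ C^T *m z = 0 /\
  (PAP A C - lam%:M) *m (PAP A C - lam%:M) *m z
    = (gammav C b ^- 2) *: (b0v A C b *m (b0v A C b)^T *m z).
Definition QEP_minimizer (n m : nat) (A : 'M[R]_n) (C : 'M[R]_(n, m))
  (b : 'cV[R]_m) (lam : R) (z : 'cV[R]_n) : Prop :=
  QEP_feasible A C b lam z /\
  forall lam' z', QEP_feasible A C b lam' z' -> lam <= lam'.

Definition QEP_hard_case (n m : nat) (A : 'M[R]_n) (C : 'M[R]_(n, m))
  (b : 'cV[R]_m) : Prop :=
  exists lam z, QEP_minimizer A C b lam z /\ (b0v A C b)^T *m z = 0.
Definition QEP_easy_case (n m : nat) (A : 'M[R]_n) (C : 'M[R]_(n, m))
  (b : 'cV[R]_m) : Prop := ~ QEP_hard_case A C b.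

(* Lanczos process on M with starting vector b0.
   State (q_{j-1}, q_j, beta_j); lanczos_state M b0 i is the state for j = i+1. *)
Definition lanczos_step (n : nat) (M : 'M[R]_n)
  (s : 'cV[R]_n * 'cV[R]_n * R) : 'cV[R]_n * 'cV[R]_n * R :=
  let: (qprev, qj, betaj) := s in
  let alphaj := (qj^T *m M *m qj) 0 0 in
  let qhat := M *m qj - alphaj *: qj - betaj *: qprev in
  let betaj1 := vnorm qhat in
  (qj, betaj1^-1 *: qhat, betaj1).

Fixpoint lanczos_state (n : nat) (M : 'M[R]_n) (b0 : 'cV[R]_n) (i : nat)
  : 'cV[R]_n * 'cV[R]_n * R :=
  match i with
  | 0 => (0, (vnorm b0)^-1 *: b0, vnorm b0)
  | i'.+1 => lanczos_step M (lanczos_state M b0 i')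
  end.

Definition lanczos_q (n : nat) (M : 'M[R]_n) (b0 : 'cV[R]_n) (j : nat)
  : 'cV[R]_n :=
  match j with 0 => 0 | j'.+1 => (lanczos_state M b0 j').1.2 end.

Definition lanczos_beta (n : nat) (M : 'M[R]_n) (b0 : 'cV[R]_n) (j : nat) : R :=
  match j with 0 => 0 | j'.+1 => (lanczos_state M b0 j').2 end.

Definition lanczos_Q (n : nat) (M : 'M[R]_n) (b0 : 'cV[R]_n) (k : nat)
  : 'M[R]_(n, k) := \matrix_(i < n, j < k) lanczos_q M b0 j.+1 i 0.

Definition lanczos_T (n : nat) (M : 'M[R]_n) (b0 : 'cV[R]_n) (k : nat)
  : 'M[R]_k := (lanczos_Q M b0 k)^T *m M *m lanczos_Q M b0 k.

Definition e1 (k : nat) : 'cV[R]_k := \col_(i < k) (nat_of_ord i == 0%N)%:R.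

Definition rLG_feasible (n m : nat) (A : 'M[R]_n) (C : 'M[R]_(n, m))
  (b : 'cV[R]_m) (k : nat) (lam : R) (x : 'cV[R]_k) : Prop :=
  (lanczos_T (PAP A C) (b0v A C b) k - lam%:M) *m x
     = - (vnorm (b0v A C b) *: e1 k)
  /\ vnorm x = gammav C b.
Definition rLG_minimizer (n m : nat) (A : 'M[R]_n) (C : 'M[R]_(n, m))
  (b : 'cV[R]_m) (k : nat) (lam : R) (x : 'cV[R]_k) : Prop :=
  rLG_feasible A C b lam x /\
  forall lam' (x' : 'cV[R]_k), rLG_feasible A C b lam' x' -> lam <= lam'.

End Defs.

Arguments rLG_feasible {R n m} A C b k lam x.
Arguments rLG_minimizer {R n m} A C b k lam x.

(* Main.v *)
(** For [w] in the null space of [C^T], write [w = S1 y] with [|y| = gamma] and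
    [H = S1^T A S1], [g = S1^T A n0]: up to a constant, [h (n0 + w)] is
    [q y = y^T H y + 2 g^T y].  The least Lagrange multiplier of [q] on a sphere
    makes [H - lam I] positive semidefinite, so that
    [q w - q y = (w - y)^T (H - lam I) (w - y)] for any [w] on the sphere; in the
    easy case [H - lam I] is even positive definite.  The same fact for [T_k] shows
    that [v^(k)] minimizes [h] over [n0 + range Q_k], which gives monotonicity.
    The rate follows by comparing with the point of the Krylov space obtained by
    rescaling to the sphere the approximation of [y = - (H - lam I)^-1 g] whose
    error is [p (H - lam I) y] for the shifted Chebyshev polynomial [p]. *)
Require Import Defs.
From HB Require Import structures.
From mathcomp Require Import all_boot all_order all_algebra.
From mathcomp Require Import boolp classical_sets reals.
From mathcomp Require Import topology normedtype derive.
From mathcomp Require Import spectral complex.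
From mathcomp Require Import zify ring lra.
Set Implicit Arguments.
Unset Strict Implicit.
Unset Printing Implicit Defensive.
Import Order.TTheory GRing.Theory Num.Theory.
Import numFieldNormedType.Exports.
Local Open Scope ring_scope.

(** * Euclidean norm *)

(** Locked so that simplification does not expose the underlying matrix entry. *)
HB.lock Definition dot (R : realType) (p : nat) (x y : 'cV[R]_p) : R :=
  (x^T *m y) 0 0.

Section Dot.
Variable R : realType.

Lemma dotE (p : nat) (x y : 'cV[R]_p) : dot x y = \sum_i x i 0 * y i 0.
Proof. by rewrite dot.unlock mxE; apply: eq_bigr => i _; rewrite mxE. Qed.

Lemma dotC (p : nat) (x y : 'cV[R]_p) : dot x y = dot y x.
Proof. by rewrite !dotE; apply: eq_bigr => i _; rewrite mulrC. Qed.

Lemma dotDr (p : nat) (x y z : 'cV[R]_p) : dot x (y + z) = dot x y + dot x z.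
Proof. by rewrite dot.unlock mulmxDr mxE. Qed.

Lemma dotDl (p : nat) (x y z : 'cV[R]_p) : dot (x + y) z = dot x z + dot y z.
Proof. by rewrite !(dotC _ z) dotDr. Qed.

Lemma dotZr (p : nat) (a : R) (x y : 'cV[R]_p) : dot x (a *: y) = a * dot x y.
Proof. by rewrite dot.unlock -scalemxAr mxE. Qed.

Lemma dotZl (p : nat) (a : R) (x y : 'cV[R]_p) : dot (a *: x) y = a * dot x y.
Proof. by rewrite dotC dotZr dotC. Qed.

Lemma dotNr (p : nat) (x y : 'cV[R]_p) : dot x (- y) = - dot x y.
Proof. by rewrite -scaleN1r dotZr mulN1r. Qed.

Lemma dotNl (p : nat) (x y : 'cV[R]_p) : dot (- x) y = - dot x y.
Proof. by rewrite dotC dotNr dotC. Qed.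

Lemma dot0r (p : nat) (x : 'cV[R]_p) : dot x 0 = 0.
Proof. by rewrite dot.unlock mulmx0 mxE. Qed.

Definition dot_lin := (dotDr, dotDl, dotNr, dotNl, dotZr, dotZl).

Lemma dot_mull (p q : nat) (M : 'M[R]_(p, q)) (x : 'cV[R]_q) (y : 'cV[R]_p) :
  dot (M *m x) y = dot x (M^T *m y).
Proof. by rewrite dot.unlock trmx_mul mulmxA. Qed.

Lemma dot_sym (p : nat) (M : 'M[R]_p) (x y : 'cV[R]_p) :
  M^T = M -> dot x (M *m y) = dot y (M *m x).
Proof. by move=> sM; rewrite dotC dot_mull sM. Qed.

Lemma dot_isom (p q : nat) (Q : 'M[R]_(p, q)) (x y : 'cV[R]_q) :
  Q^T *m Q = 1%:M -> dot (Q *m x) (Q *m y) = dot x y.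
Proof. by move=> QQ; rewrite dot_mull mulmxA QQ mul1mx. Qed.

Lemma dot_ge0 (p : nat) (x : 'cV[R]_p) : 0 <= dot x x.
Proof. by rewrite dotE sumr_ge0 // => i _; rewrite -expr2 sqr_ge0. Qed.

Lemma dot_eq0 (p : nat) (x : 'cV[R]_p) : (dot x x == 0) = (x == 0).
Proof.
apply/eqP/eqP => [|->]; last by rewrite dot0r.
rewrite dotE => x0; apply/matrixP => i j; rewrite ord1 mxE.
have /psumr_eq0P/(_ x0 i isT)/eqP : forall i, true -> 0 <= x i 0 * x i 0.
  by move=> k _; rewrite -expr2 sqr_ge0.
by rewrite mulf_eq0 orbb => /eqP.
Qed.

Lemma vnormE (p : nat) (x : 'cV[R]_p) : vnorm x = Num.sqrt (dot x x).
Proof.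
by rewrite /vnorm dotE; congr Num.sqrt; apply: eq_bigr => i _; rewrite expr2.
Qed.

Lemma vnorm_ge0 (p : nat) (x : 'cV[R]_p) : 0 <= vnorm x.
Proof. by rewrite vnormE sqrtr_ge0. Qed.

Lemma vnorm_sq (p : nat) (x : 'cV[R]_p) : vnorm x ^+ 2 = dot x x.
Proof. by rewrite vnormE sqr_sqrtr ?dot_ge0. Qed.

Lemma vnorm_le (p : nat) (x : 'cV[R]_p) (c : R) :
  0 <= c -> dot x x <= c ^+ 2 -> vnorm x <= c.
Proof. by move=> c0; rewrite -vnorm_sq ler_pXn2r // nnegrE ?vnorm_ge0. Qed.

Lemma vnorm_eqP (p : nat) (x : 'cV[R]_p) (c : R) :
  0 <= c -> vnorm x = c <-> dot x x = c ^+ 2.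
Proof.
move=> c0; split=> [<-|]; first by rewrite vnorm_sq.
by rewrite vnormE => ->; rewrite sqrtr_sqr ger0_norm.
Qed.

Lemma vnorm_eq0 (p : nat) (x : 'cV[R]_p) : (vnorm x == 0) = (x == 0).
Proof. by rewrite -dot_eq0 -vnorm_sq sqrf_eq0. Qed.

Lemma vnormZ (p : nat) (a : R) (x : 'cV[R]_p) : vnorm (a *: x) = `|a| * vnorm x.
Proof.
apply/vnorm_eqP; first by rewrite mulr_ge0 ?vnorm_ge0.
by rewrite !dot_lin exprMn vnorm_sq real_normK ?num_real // mulrA expr2.
Qed.

Lemma vnorm_isom (p q : nat) (Q : 'M[R]_(p, q)) (x : 'cV[R]_q) :
  Q^T *m Q = 1%:M -> vnorm (Q *m x) = vnorm x.
Proof. by move=> QQ; rewrite !vnormE dot_isom. Qed.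

Lemma cauchy_schwarz (p : nat) (x y : 'cV[R]_p) : `|dot x y| <= vnorm x * vnorm y.
Proof.
have [->|x0] := eqVneq x 0.
  by rewrite dotC dot0r normr0 mulr_ge0 ?vnorm_ge0.
have xx : 0 < dot x x by rewrite lt_def dot_eq0 x0 dot_ge0.
rewrite -(@ler_pXn2r _ 2) ?nnegrE ?mulr_ge0 ?vnorm_ge0 //.
rewrite exprMn !vnorm_sq real_normK ?num_real //.
(* This vector is [dot x x] times the component of [y] orthogonal to [x]; expanding its squared
   length leaves one spare factor [dot x x]. *)
have := dot_ge0 (dot x x *: y - dot x y *: x).
rewrite !dot_lin (dotC y x) => h.
rewrite -(ler_pM2l xx); move: h; lra.
Qed.

Lemma vnormD (p : nat) (x y : 'cV[R]_p) : vnorm (x + y) <= vnorm x + vnorm y.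
Proof.
apply: vnorm_le; first by rewrite addr_ge0 ?vnorm_ge0.
have := le_trans (ler_norm _) (cauchy_schwarz x y).
rewrite sqrrD !vnorm_sq !dot_lin (dotC y x); lra.
Qed.

Lemma vnormBC (p : nat) (x y : 'cV[R]_p) : vnorm (x - y) = vnorm (y - x).
Proof. by rewrite -opprB -scaleN1r vnormZ normrN1 mul1r. Qed.

Lemma vnorm_dist (p : nat) (x y : 'cV[R]_p) : `|vnorm x - vnorm y| <= vnorm (x - y).
Proof.
have h1 := vnormD (x - y) y; have h2 := vnormD (y - x) x.
rewrite !subrK (vnormBC y) in h1 h2.
rewrite ler_norml; apply/andP; split; lra.
Qed.

(** Rescaling moves [w] by the difference of the two norms, which the reverse triangle inequality
    bounds by the distance from [w] to [y]; hence the factor 2. *)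
Lemma rescale_dist (p : nat) (w y : 'cV[R]_p) :
  w != 0 -> vnorm ((vnorm y / vnorm w) *: w - y) <= 2 * vnorm (w - y).
Proof.
move=> w0; have nw : vnorm w != 0 by rewrite vnorm_eq0.
have -> : (vnorm y / vnorm w) *: w - y
    = ((vnorm y - vnorm w) / vnorm w) *: w + (w - y).
  by rewrite addrA; congr (_ - _); rewrite mulrBl divff // scalerBl scale1r subrK.
apply: le_trans (vnormD _ _) _.
rewrite vnormZ normrM normfV (ger0_norm (vnorm_ge0 w)) divfK //.
have := vnorm_dist y w; rewrite vnormBC; lra.
Qed.

End Dot.

(** * Quadratic functions on spheres *)

Section TrustRegion.
Variable R : realType.

(** Stands for letting [t] tend to 0. If [c > 0], then [t = c / (2 * B)] gives [c <= c / 2]; should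
    this [t] exceed 1, then [2 * B < c] and [t = 1/2] is contradictory. *)
Lemma linear_small_bound (c B : R) :
  (forall t, 0 < t -> t <= 1 -> c <= t * B) -> c <= 0.
Proof.
move=> h; rewrite leNgt; apply/negP => c0.
have B0 : 0 < B by have := h 1 ltr01 (lexx _); rewrite mul1r; apply: lt_le_trans.
have [cB|cB] := lerP (c / (2 * B)) 1.
  have := h (c / (2 * B)); rewrite divr_gt0 ?mulr_gt0 // => /(_ isT cB).
  have -> : c / (2 * B) * B = c / 2 by field; rewrite gt_eqF.
  lra.
move: cB; rewrite ltr_pdivlMr ?mulr_gt0 // => cB.
have := h 2^-1; rewrite invr_gt0 ltr0n => /(_ isT); lra.
Qed.

Lemma continuous_coord_cV (p : nat) (i : 'I_p) :
  continuous (fun v : 'rV[R]_p => v ord0 i).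
Proof. exact: coord_continuous. Qed.

Lemma continuous_sumr (T : topologicalType) (I : finType) (f : I -> T -> R) :
  (forall i, continuous (f i)) -> continuous (fun t => \sum_i f i t).
Proof.
move=> cf; apply: continuous_big => [[x y]|i _]; last exact: cf.
by apply: cvgD; [exact: cvg_fst | exact: cvg_snd].
Qed.

Lemma continuous_mulr (T : topologicalType) (f g : T -> R) :
  continuous f -> continuous g -> continuous (fun t => f t * g t).
Proof. by move=> cf cg t; apply: cvgM; [exact: cf | exact: cg]. Qed.

Lemma continuous_addr (T : topologicalType) (f g : T -> R) :
  continuous f -> continuous g -> continuous (fun t => f t + g t).
Proof. by move=> cf cg t; apply: cvgD; [exact: cf | exact: cg]. Qed.

Definition quad (p : nat) (H : 'M[R]_p) (g y : 'cV[R]_p) : R :=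
  dot y (H *m y) + 2 * dot g y.

(** Extreme value theorem on a compact sphere, which [y0] shows to be nonempty. Norm and objective
    are transported to row vectors, where closed bounded sets are known to be compact. *)
Lemma sphere_min_exists (p : nat) (H : 'M[R]_p) (g : 'cV[R]_p) (c : R)
    (y0 : 'cV[R]_p) :
  dot y0 y0 = c ->
  exists2 y, dot y y = c & forall w, dot w w = c -> quad H g y <= quad H g w.
Proof.
move=> y0c.
pose n2 (v : 'rV[R]_p) := \sum_i v ord0 i * v ord0 i.
pose f (v : 'rV[R]_p) := (\sum_i v ord0 i * (\sum_j H i j * v ord0 j))
  + 2 * \sum_i g i 0 * v ord0 i.
have n2E (y : 'cV_p) : n2 y^T = dot y y.
  by rewrite dotE; apply: eq_bigr => i _; rewrite mxE.
have fE (y : 'cV_p) : f y^T = quad H g y.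
  rewrite /f /quad !dotE; congr (_ + 2 * _); apply: eq_bigr => i _.
    by rewrite !mxE; congr (_ * _); apply: eq_bigr => j _; rewrite mxE.
  by rewrite mxE.
have cn2 : continuous n2.
  apply: continuous_sumr => i.
  by apply: continuous_mulr; exact: continuous_coord_cV.
have cst (a : R) : continuous (fun _ : 'rV[R]_p => a) by exact: cst_continuous.
have cf : continuous f.
  apply: continuous_addr; last first.
    apply: (continuous_mulr (@cst 2)); apply: continuous_sumr => i.
    by apply: continuous_mulr; [exact: cst | exact: continuous_coord_cV].
  apply: continuous_sumr => i; apply: continuous_mulr.
    exact: continuous_coord_cV.
  apply: continuous_sumr => j.
  by apply: continuous_mulr; [exact: cst | exact: continuous_coord_cV].
pose S := (n2 @^-1` [set c])%classic.
have Sne : (S !=set0)%classic by exists y0^T; rewrite /S /= n2E.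
have c0 : 0 <= c by rewrite -y0c dot_ge0.
have Scpt : compact S.
  apply: bounded_closed_compact; last first.
    by apply: preimage_closed => //; exact: closed_eq.
  exists (Num.sqrt c); split; first exact: num_real.
  move=> a ca w Sw; apply: le_trans (ltW ca).
  rewrite [leLHS]/Num.norm /= mx_normrE; apply/bigmax_leP.
  split; first exact: sqrtr_ge0.
  move=> [i j] _ /=; rewrite ord1 -(@ler_pXn2r _ 2) ?nnegrE ?sqrtr_ge0 //.
  rewrite sqr_sqrtr // real_normK ?num_real // -Sw /n2 (bigD1 j) //= expr2.
  by rewrite lerDl sumr_ge0 // => k _; rewrite -expr2 sqr_ge0.
have [v vS vmin] := compact_EVT_min Sne Scpt (continuous_subspaceT cf).
exists v^T; first by move: vS; rewrite inE /S /= -n2E trmxK.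
move=> w wc; rewrite -!fE trmxK; apply: vmin.
by rewrite inE /S /= n2E.
Qed.

(** On a sphere the last term is constant, so shifting [H] does not change the minimizers. *)
Lemma quad_shift (p : nat) (H : 'M[R]_p) (g w : 'cV[R]_p) (lam : R) :
  quad H g w = quad (H - lam%:M) g w + lam * dot w w.
Proof. rewrite /quad mulmxBl mul_scalar_mx !dot_lin; ring. Qed.

Lemma symB_scalar (p : nat) (H : 'M[R]_p) (lam : R) :
  H^T = H -> (H - lam%:M)^T = H - lam%:M.
Proof. by move=> sH; rewrite linearB /= tr_scalar_mx sH. Qed.

(** Completing the square: the stationarity equation eliminates [g], and the shifts by [lam] cancel
    because the norms agree. *)
Lemma quad_diff (p : nat) (H : 'M[R]_p) (g y w : 'cV[R]_p) (lam : R) :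
  H^T = H -> (H - lam%:M) *m y = - g -> dot w w = dot y y ->
  quad H g w - quad H g y = dot (w - y) ((H - lam%:M) *m (w - y)).
Proof.
move=> sH ey wy; rewrite !(quad_shift H _ _ lam) wy /quad.
have -> : g = - ((H - lam%:M) *m y) by rewrite ey opprK.
set K := H - _; have sK : K^T = K by exact: symB_scalar.
rewrite mulmxBr !dot_lin (dotC (K *m y)) (dotC (K *m y) y) (dot_sym y w sK); ring.
Qed.

(* Compares y with its reflection y - 2 (d.y)/(d.d) d, which stays on the sphere. *)
Lemma sphere_min_reflection (p : nat) (K : 'M[R]_p) (g y d : 'cV[R]_p) :
  K^T = K -> (forall w, dot w w = dot y y -> quad K g y <= quad K g w) ->
  dot d y * dot d d * dot d (K *m y + g) <= dot d y ^+ 2 * dot d (K *m d).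
Proof.
move=> sK ymin; have [->|d0] := eqVneq d 0.
  by rewrite !(dotC 0) !dot0r expr0n /= !mul0r.
have dd : dot d d != 0 by rewrite dot_eq0.
pose s := 2 * dot d y / dot d d.
have ws : dot (y - s *: d) (y - s *: d) = dot y y.
  by rewrite !dot_lin (dotC y d) /s; field.
have := ymin _ ws.
rewrite /quad mulmxBr -scalemxAr !dot_lin (dot_sym y d sK) (dotC g d) => h.
(* The factor clears the denominators of [s] and [s ^+ 2]. *)
have : 0 <= dot d d ^+ 2 / 4 * (- 2 * s * dot d (K *m y) + s ^+ 2 * dot d (K *m d)
       - 2 * s * dot d g).
  rewrite mulr_ge0 ?divr_ge0 ?sqr_ge0 //; move: h; lra.
move=> h0; rewrite -subr_ge0; apply: le_trans h0 _; rewrite le_eqVlt; apply/orP; left.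
apply/eqP; rewrite /s; field; exact: dd.
Qed.

(** The multiplier is chosen so that the residual [r = K *m y + g] is orthogonal to [y]. The
    reflection inequality along [r + t *: y] then forces [r = 0], after which the same inequality
    yields semidefiniteness. *)
Lemma sphere_min_multiplier (p : nat) (H : 'M[R]_p) (g y : 'cV[R]_p) :
  H^T = H -> 0 < dot y y ->
  (forall w, dot w w = dot y y -> quad H g y <= quad H g w) ->
  exists lam, (H - lam%:M) *m y = - g /\
              forall d, 0 <= dot d ((H - lam%:M) *m d).
Proof.
move=> sH yy ymin; pose lam := dot y (H *m y + g) / dot y y.
exists lam; set K := H - _.
have sK : K^T = K by exact: symB_scalar.
have Kmin w : dot w w = dot y y -> quad K g y <= quad K g w.
  move=> wy; have := ymin w wy; rewrite !(quad_shift H _ _ lam) wy; lra.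
have refl d := sphere_min_reflection d sK Kmin.
have [r rE] : exists r, r = K *m y + g by exists (K *m y + g).
rewrite -rE in refl.
have ry : dot r y = 0.
  rewrite dotC rE /K mulmxBl mul_scalar_mx !dot_lin /lam !dot_lin; field.
  by rewrite gt_eqF.
have r0 : r = 0.
  apply/eqP; rewrite -dot_eq0 eq_le dot_ge0 andbT.
  suff : dot r r ^+ 2 <= 0.
    move=> h; have : dot r r ^+ 2 == 0 by rewrite eq_le h sqr_ge0.
    by rewrite sqrf_eq0 => /eqP ->.
  pose a0 := dot r (K *m r); pose a1 := dot r (K *m y); pose a2 := dot y (K *m y).
  apply: (@linear_small_bound _ (dot y y * (`|a0| + 2 * `|a1| + `|a2|))) => t t0 t1.
  (* Here [dot d y = t * dot y y] and [dot d r = dot r r]; division by [t * dot y y] bounds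
     [dot r r ^+ 2] by a multiple of [t]. *)
  have := refl (r + t *: y).
  have ry' : dot y r = 0 by rewrite dotC.
  rewrite mulmxDr -scalemxAr !dot_lin (dot_sym y r sK) ry ry' -/a0 -/a1 -/a2.
  rewrite !mulr0 !add0r !addr0 => h.
  have tY : 0 < t * dot y y by rewrite mulr_gt0.
  have h1 : (dot r r + t * (t * dot y y)) * dot r r
            <= t * dot y y * (a0 + t * a1 + t * (a1 + t * a2)).
    by rewrite -(ler_pM2l tY); move: h; lra.
  have h2 : a0 + t * a1 + t * (a1 + t * a2) <= `|a0| + 2 * `|a1| + `|a2|.
    have bnd (a u : R) : 0 <= u -> u <= 1 -> u * a <= `|a|.
      move=> u0 u1; apply: le_trans (ler_norm _) _.
      by rewrite normrM ger0_norm // ler_piMl.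
    have := bnd a1 t (ltW t0) t1; have := ler_norm a0.
    have := bnd a2 (t * t); rewrite mulr_ge0 ?(ltW t0) // => /(_ isT).
    rewrite mulr_ile1 ?(ltW t0) // => /(_ isT); lra.
  rewrite mulrA; apply: le_trans (le_trans h1 _); last by rewrite ler_pM2l.
  by rewrite mulrDl -expr2 lerDl !mulr_ge0 ?dot_ge0 ?(ltW t0) // ltW.
have Ky : K *m y = - g by apply/eqP; rewrite -addr_eq0 -rE r0.
split=> // d.
have pos e : dot e y != 0 -> 0 <= dot e (K *m e).
  move=> ey; have := refl e; rewrite r0 dot0r mulr0.
  by rewrite pmulr_rge0 // lt_def sqrf_eq0 ey sqr_ge0.
(* The reflection along [d] is trivial when [d] is orthogonal to [y]; such a [d] is approached by
   [d + t *: y]. *)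
have [dy|] := eqVneq (dot d y) 0; last exact: pos.
rewrite -oppr_le0.
apply: (@linear_small_bound _ (2 * dot d (K *m y) + `|dot y (K *m y)|)) => t t0 t1.
have := pos (d + t *: y); rewrite !dot_lin dy add0r mulf_neq0 ?gt_eqF // => /(_ isT).
rewrite mulmxDr -scalemxAr !dot_lin (dot_sym y d sK) => h.
have : t * (t * dot y (K *m y)) <= t * `|dot y (K *m y)|.
  rewrite ler_pM2l //; apply: le_trans (ler_norm _) _.
  by rewrite normrM ger0_norm ?(ltW t0) // ler_piMl.
lra.
Qed.

End TrustRegion.

(** * Spectral decomposition *)

(** The spectral theorem is applied over [R[i]] and brought back to [R]: the [d i] are the real
    eigenvalues, the [c i] the squared moduli of the coordinates of [x] in a unitary eigenbasis.
    Bounds on polynomials in [H] thus become termwise bounds on sums. *)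
Lemma spectral_measure (R : realType) (p : nat) (H : 'M[R]_p.+1) (x : 'cV[R]_p.+1) :
  H^T = H -> exists d c : 'I_p.+1 -> R,
  [/\ forall i, 0 <= c i, forall i, eigenvalue H (d i)
    & forall q : {poly R}, dot x (horner_mx H q *m x) = \sum_i c i * q.[d i]].
Proof.
move=> sH; pose toC : {rmorphism R -> R[i]} := real_complex R.
pose HC := map_mx toC H.
have toCconj (a : R) : Num.conj (toC a) = toC a by exact: conjc_real.
have HCherm : HC \is hermsymmx.
  apply: realsym_hermsym.
    by apply/is_hermitianmxP; rewrite expr0 scale1r map_mx_id // map_trmx sH.
  by apply/mxOverP => i j; rewrite mxE; apply/complex_realP; exists (H i j).
have HCE := orthomx_spectralP (hermitian_normalmx HCherm).
have /mxOverP spR := hermitian_spectral_diag_real HCherm.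
set P := spectralmx HC in HCE *; set sp := spectral_diag HC in HCE spR *.
have Punit : P \in unitmx by exact: spectral_unit.
have PV : invmx P = map_mx Num.conj P^T by rewrite invmx_unitary ?spectral_unitarymx.
pose d i : R := complex.Re (sp 0 i).
have dE i : toC (d i) = sp 0 i by exact: RRe_real.
pose v := P *m map_mx toC x.
pose c i : R := complex.Re (v i 0 * Num.conj (v i 0)).
have v_ge0 i : 0 <= v i 0 * Num.conj (v i 0) by exact: mul_conjC_ge0.
have cE i : toC (c i) = v i 0 * Num.conj (v i 0).
  by apply: RRe_real; exact: ger0_real.
exists d, c; split=> [i|i|q].
- by rewrite -(ler0c (c i)) -/(toC _) cE.
- rewrite -(eigenvalue_map toC) dE; apply/eigenvalueP; exists (row i P).
    rewrite -row_mul -/HC {1}HCE !mulmxA mulmxV // mul1mx mul_diag_mx.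
    by apply/rowP => j; rewrite !mxE.
  (* The rows of the invertible matrix [P] are left eigenvectors, so none of them vanishes. *)
  apply/eqP => Pi0; have : delta_mx 0 i *m P = 0 :> 'rV_p.+1 by rewrite -rowE.
  move/(congr1 (mulmx^~ (invmx P))); rewrite mulmxK // mul0mx => /matrixP/(_ 0 i).
  by rewrite !mxE !eqxx => /eqP; rewrite oner_eq0.
- apply: (fmorph_inj toC).
  pose qC := map_poly toC q.
  have hq : map_mx toC (horner_mx H q) = invmx P *m horner_mx (diag_mx sp) qC *m P.
    rewrite map_horner_mx -/HC -/qC {1}HCE.
    by rewrite horner_mx_uconjC.
  have xP : (map_mx toC x)^T *m invmx P = map_mx Num.conj v^T.
    rewrite PV /v trmx_mul map_mxM; congr (_ *m _).
    by apply/matrixP => i j; rewrite !mxE; exact/esym/toCconj.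
  have -> : toC (dot x (horner_mx H q *m x))
      = (map_mx toC (x^T *m (horner_mx H q *m x))) 0 0 by rewrite dot.unlock [RHS]mxE.
  rewrite map_mxM -map_trmx map_mxM hq !mulmxA xP -!mulmxA -/v horner_mx_diag.
  clearbody c; clear xP; clearbody v.
  rewrite mul_diag_mx mxE rmorph_sum; apply: eq_bigr => i _ /=.
  rewrite !mxE rmorphM /= cE -dE horner_map /=; ring.
Qed.

(** * Chebyshev polynomials *)

Section Chebyshev.
Variable R : realType.

(** Carries two consecutive Chebyshev polynomials of the first kind, which makes the three-term
    recurrence structural. *)
Fixpoint chebyshev2 (k : nat) : {poly R} * {poly R} :=
  if k is k'.+1 then
    let: (t, u) := chebyshev2 k' in (u, 2%:R *: ('X * u) - t)
  else (1, 'X).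

Definition chebyshev (k : nat) : {poly R} := (chebyshev2 k).1.

Lemma chebyshev0 : chebyshev 0 = 1. Proof. by []. Qed.

Lemma chebyshev1 : chebyshev 1 = 'X. Proof. by []. Qed.

Lemma chebyshevSS (k : nat) :
  chebyshev k.+2 = 2%:R *: ('X * chebyshev k.+1) - chebyshev k.
Proof. by rewrite /chebyshev /=; case: (chebyshev2 k). Qed.

Lemma chebyshev_ind2 (P : nat -> Prop) :
  P 0%N -> P 1%N -> (forall k, P k -> P k.+1 -> P k.+2) -> forall k, P k.
Proof.
move=> P0 P1 PSS k; suff: P k /\ P k.+1 by case.
by elim: k => [|k [Pk PSk]]; split=> //; exact: PSS.
Qed.

Lemma size_chebyshev (k : nat) : (size (chebyshev k) <= k.+1)%N.
Proof.
elim/chebyshev_ind2: k => [||k sk sSk].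
- by rewrite size_poly1.
- by rewrite size_polyX.
rewrite chebyshevSS (leq_trans (size_polyD _ _)) // geq_max size_polyN.
rewrite (leq_trans sk (leqW (leqnSn _))) andbT (leq_trans (size_scale_leq _ _)) //.
by rewrite (leq_trans (size_polyMleq _ _)) // size_polyX add2n.
Qed.

Lemma horner_chebyshevSS (k : nat) (x : R) :
  (chebyshev k.+2).[x] = 2 * x * (chebyshev k.+1).[x] - (chebyshev k).[x].
Proof. by rewrite chebyshevSS hornerD hornerN hornerZ hornerM hornerX mulrA. Qed.

(** The recurrence preserves this quadratic form in two consecutive values, so its value is the one
    at [k = 0]. *)
Lemma chebyshev_pell (k : nat) (x : R) :
  (chebyshev k).[x] ^+ 2 - 2 * x * (chebyshev k).[x] * (chebyshev k.+1).[x]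
    + (chebyshev k.+1).[x] ^+ 2 = 1 - x ^+ 2.
Proof.
elim: k => [|k IH]; first by rewrite chebyshev0 chebyshev1 !hornerE; ring.
rewrite -IH horner_chebyshevSS; ring.
Qed.

Lemma chebyshev_1 (k : nat) : (chebyshev k).[1] = 1.
Proof.
elim/chebyshev_ind2: k => [||k ek eSk]; rewrite ?chebyshev0 ?chebyshev1 ?hornerE //.
by rewrite horner_chebyshevSS ek eSk; ring.
Qed.

Lemma chebyshev_N1 (k : nat) : (chebyshev k).[-1] = (-1) ^+ k.
Proof.
elim/chebyshev_ind2: k => [||k ek eSk]; rewrite ?chebyshev0 ?chebyshev1 ?hornerE //.
by rewrite horner_chebyshevSS ek eSk !exprS; ring.
Qed.

(* By the Pell-type identity, (1 - x^2)(1 - T_k(x)^2) is a square. *)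
Lemma chebyshev_bound (k : nat) (x : R) :
  -1 <= x <= 1 -> `|(chebyshev k).[x]| <= 1.
Proof.
move=> /andP[x1 x2].
(* The factor [1 - x ^+ 2] vanishes at both endpoints, where the values are known explicitly. *)
have [->|n1] := eqVneq x 1; first by rewrite chebyshev_1 normr1.
have [->|n2] := eqVneq x (-1); first by rewrite chebyshev_N1 normrX normrN1 expr1n.
have xlt : 0 < 1 - x ^+ 2.
  have x1' : -1 < x by rewrite lt_neqAle eq_sym n2.
  have x2' : x < 1 by rewrite lt_neqAle n1.
  nra.
rewrite -(@ler_pXn2r _ 2) ?nnegrE // real_normK ?num_real // expr1n.
rewrite -subr_ge0 -(pmulr_rge0 _ xlt).
have -> : (1 - x ^+ 2) * (1 - (chebyshev k).[x] ^+ 2) =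
   ((chebyshev k.+1).[x] - x * (chebyshev k).[x]) ^+ 2.
  by rewrite mulrBr mulr1 -{1}(chebyshev_pell k x); ring.
exact: sqr_ge0.
Qed.

(** Both [z ^+ k] and [z ^- k] solve the recurrence when [2 * x = z + z^-1]. This gives the growth
    outside [[-1, 1]]. *)
Lemma chebyshev_joukowski (k : nat) (z : R) : z != 0 ->
  (chebyshev k).[(z + z^-1) / 2] = (z ^+ k + z ^- k) / 2.
Proof.
move=> z0; elim/chebyshev_ind2: k => [||k ek eSk].
- by rewrite chebyshev0 hornerE expr0 invr1; field.
- by rewrite chebyshev1 hornerE expr1.
rewrite horner_chebyshevSS ek eSk !exprS.
by field; rewrite z0 expf_neq0.
Qed.

(* For [a = b] the junk value [Gam = 2 / 0 = 0] makes [D^-1 = 0], and the bound asks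
   for a polynomial that vanishes at [a]. *)
Lemma chebyshev_shifted (a b : R) (k : nat) : 0 < a -> a <= b -> (0 < k)%N ->
  let Gam := (Num.sqrt (b / a) + 1) / (Num.sqrt (b / a) - 1) in
  let D := Gam ^+ k + Gam ^- k in
  0 <= D^-1 /\
  exists p : {poly R}, [/\ (size p <= k.+1)%N, p.[0] = 1
    & forall t, a <= t <= b -> `|p.[t]| <= 2 * D^-1].
Proof.
move=> a0 ab k0 Gam D.
(* In this case [0 < k] serves twice: it makes [0 ^+ k] vanish in [D], and it allows the linear
   polynomial [1 - t / a]. *)
have [eab|nab] := eqVneq a b.
  have D0 : D = 0.
    rewrite /D /Gam eab divff ?sqrtr1; last by rewrite -eab gt_eqF.
    by rewrite subrr invr0 mulr0 expr0n gtn_eqF // invr0 addr0.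
  rewrite D0 invr0 mulr0; split=> //; exists (1 - a^-1 *: 'X); split.
  - rewrite (leq_trans (size_polyD _ _)) // geq_max size_poly1 size_polyN /=.
    by rewrite (leq_trans (size_scale_leq _ _)) // size_polyX.
  - by rewrite !hornerE; ring.
  move=> t; rewrite -eab => /le_anti <-.
  by rewrite !hornerE mulVf ?gt_eqF // subrr normr0.
have {nab}ab : a < b by rewrite lt_neqAle nab.
pose s := Num.sqrt (b / a).
have b0 : 0 < b := lt_trans a0 ab.
have s1 : 1 < s by rewrite -[ltLHS]sqrtr1 ltr_sqrt ?divr_gt0 // ltr_pdivlMr // mul1r.
have s2 : s ^+ 2 = b / a by rewrite sqr_sqrtr // divr_ge0 // ltW.
have bE : b = a * s ^+ 2 by rewrite s2 mulrC divfK ?gt_eqF.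
have Gam0 : 0 < Gam by rewrite divr_gt0 ?subr_gt0 // addr_gt0 // (lt_trans ltr01).
have D0 : 0 < D by rewrite addr_gt0 ?invr_gt0 ?exprn_gt0.
split; first by rewrite invr_ge0 ltW.
(* The decreasing affine map from [[a, b]] onto [[-1, 1]]; it sends 0 to the Joukowski image of
   [Gam]. *)
pose l : {poly R} := ((b + a) / (b - a))%:P - (2 / (b - a)) *: 'X.
have ba : b - a != 0 by rewrite subr_eq0 gt_eqF.
have hl t : l.[t] = (b + a - 2 * t) / (b - a).
  by rewrite !hornerE; field.
have l0 : l.[0] = (Gam + Gam^-1) / 2.
  rewrite hl /Gam -/s bE; field.
  rewrite !gt_eqF //; nra.
(* The Chebyshev polynomial takes the value [D / 2] at [l.[0]], so this scaling gives [p.[0] =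
   1]. *)
exists ((2 / D) *: (chebyshev k \Po l)); split.
- rewrite (leq_trans (size_scale_leq _ _)) // (leq_trans (size_comp_poly_leq _ _)) // ltnS.
  rewrite -[leqRHS]muln1 leq_mul //; first by have := size_chebyshev k; case: (size _).
  rewrite -subn1 leq_subLR (leq_trans (size_polyD _ _)) // geq_max size_polyN.
  rewrite (leq_trans (size_polyC_leq1 _)) // (leq_trans (size_scale_leq _ _)) //.
  by rewrite size_polyX.
- rewrite hornerZ horner_comp l0 chebyshev_joukowski ?gt_eqF // -/D.
  by field; rewrite gt_eqF.
move=> t /andP[at1 tb]; rewrite hornerZ horner_comp normrM.
rewrite ger0_norm ?divr_ge0 ?(ltW D0) // ler_piMr ?divr_ge0 ?(ltW D0) //.
apply: chebyshev_bound; rewrite hl ler_pdivlMr ?ler_pdivrMr ?subr_gt0 //.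
by apply/andP; split; lra.
Qed.

End Chebyshev.

(** * Lanczos process *)

Section Lanczos.
Variables (R : realType) (n : nat) (M : 'M[R]_n) (b0 : 'cV[R]_n).
Hypothesis sM : M^T = M.

Local Notation q := (lanczos_q M b0).
Local Notation beta := (lanczos_beta M b0).
Local Notation alpha := (fun j => dot (q j) (M *m q j)).

#[local] Arguments lanczos_q : simpl never.

Lemma lanczos_stateE (i : nat) :
  lanczos_state M b0 i = (q i, q i.+1, beta i.+1).
Proof.
case: i => [//|i]; rewrite /lanczos_q /lanczos_beta /=.
by case: (lanczos_state M b0 i) => [[u v] c].
Qed.

Lemma lanczos_step_eq (i : nat) :
  let qhat := M *m q i.+1 - alpha i.+1 *: q i.+1 - beta i.+1 *: q i in
  q i.+2 = (vnorm qhat)^-1 *: qhat /\ beta i.+2 = vnorm qhat.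
Proof.
have e : lanczos_state M b0 i.+1 = lanczos_step M (q i, q i.+1, beta i.+1).
  by rewrite [LHS]/= lanczos_stateE.
have -> : q i.+2 = (lanczos_state M b0 i.+1).1.2 by [].
have -> : beta i.+2 = (lanczos_state M b0 i.+1).2 by [].
by rewrite e dot.unlock mulmxA.
Qed.

(** Holds at breakdown as well: a zero [qhat] makes both [beta i.+2] and [q i.+2] zero. *)
Lemma lanczos_recurrence (i : nat) :
  M *m q i.+1 = beta i.+2 *: q i.+2 + alpha i.+1 *: q i.+1 + beta i.+1 *: q i.
Proof.
have [-> ->] := lanczos_step_eq i; set h := (M *m _ - _ - _).
have -> : vnorm h *: ((vnorm h)^-1 *: h) = h.
  have [h0|h0] := eqVneq h 0; first by rewrite h0 !scaler0.
  by rewrite scalerA divff ?vnorm_eq0 // scale1r.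
by rewrite /h addrAC !subrK.
Qed.

Lemma lanczos_q_unit (i : nat) : beta i.+1 != 0 -> dot (q i.+1) (q i.+1) = 1.
Proof.
have unit (h : 'cV[R]_n) : vnorm h != 0 ->
    dot ((vnorm h)^-1 *: h) ((vnorm h)^-1 *: h) = 1.
  by move=> h0; rewrite dotZl dotZr -vnorm_sq; field.
case: i => [|i] bi; first exact: unit.
by have [-> eb] := lanczos_step_eq i; apply: unit; rewrite -eb.
Qed.

Lemma lanczos_orthonormal (N : nat) : (forall k, (k <= N)%N -> beta k.+1 != 0) ->
  forall i j, (i <= N)%N -> (j <= N)%N -> dot (q i.+1) (q j.+1) = (i == j)%:R.
Proof.
elim: N => [|N IH] bN.
  by move=> [|i] [|j] // _ _; rewrite eqxx lanczos_q_unit ?bN.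
have {}IH := IH (fun k kN => bN k (leqW kN)).
(* Extends the induction hypothesis to the convention [q 0 = 0]. *)
have qprev i j : (i <= N)%N -> (j <= N)%N -> dot (q i) (q j.+1) = (i == j.+1)%:R.
  case: i => [|i] iN jN; first by rewrite dotC dot0r.
  by rewrite IH // ltnW.
have new i : (i <= N)%N -> dot (q N.+2) (q i.+1) = 0.
  move=> iN; apply: (mulfI (bN N.+1 (leqnn _))); rewrite mulr0 -dotZl.
  have := lanczos_recurrence N => /(congr1 (fun z => dot z (q i.+1))) /=.
  rewrite !dotDl !dotZl (IH N i) // (qprev N i) // => eN.
  have -> : beta N.+2 * dot (q N.+2) (q i.+1) = dot (M *m q N.+1) (q i.+1)
      - alpha N.+1 * (N == i)%:R - beta N.+1 * (N == i.+1)%:R by rewrite eN; ring.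
  (* Testing against the latest vector, the [alpha] term cancels by its definition. *)
  have [<-|Ni] := eqVneq N i.
    by rewrite dotC /= (ltn_eqF (ltnSn N)) mulr1 !mulr0 subrr subr0.
  have iN' : (i < N)%N by rewrite ltn_neqAle eq_sym Ni.
  (* Symmetry moves [M] onto [q i.+1], whose image involves only [q i], [q i.+1] and [q i.+2]. Only
     [i.+1 = N] contributes, and its [beta N.+1] cancels the last term. *)
  rewrite dot_mull sM lanczos_recurrence !dotDr !dotZr !(dotC (q N.+1)).
  rewrite (qprev i N) // (IH i N) // (IH i.+1 N) //.
  rewrite (ltn_eqF iN') (ltn_eqF (iN : (i < N.+1)%N)) (eq_sym N i.+1).
  by case: eqP => [->|_]; rewrite /= ?mulr1n ?mulr0n; ring.
move=> i j; rewrite (leq_eqVlt i) (leq_eqVlt j) !ltnS => /predU1P[->|iN] /predU1P[->|jN].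
- by rewrite eqxx lanczos_q_unit ?bN.
- by rewrite new // gtn_eqF.
- by rewrite dotC new // ltn_eqF.
- exact: IH.
Qed.

Lemma col_lanczos_Q (k : nat) (j : 'I_k) : col j (lanczos_Q M b0 k) = q j.+1.
Proof. by apply/matrixP => i l; rewrite ord1 !mxE. Qed.

Lemma lanczos_Q_isom (k : nat) :
  (forall i, (i < k)%N -> beta i.+1 != 0) ->
  (lanczos_Q M b0 k)^T *m lanczos_Q M b0 k = 1%:M.
Proof.
move=> bk; apply/matrixP => i j.
have -> : ((lanczos_Q M b0 k)^T *m lanczos_Q M b0 k) i j = dot (q i.+1) (q j.+1).
  by rewrite dotE mxE; apply: eq_bigr => l _; rewrite !mxE.
case: k i j bk => [[]//|k] i j bk.
by rewrite (@lanczos_orthonormal k) ?mxE -1?ltnS.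
Qed.

(** Identifies the right-hand side of rLGopt as the restriction of [b0], which is a multiple of the
    first Lanczos vector. *)
Lemma lanczos_Q_b0 (k : nat) :
  (forall i, (i < k)%N -> beta i.+1 != 0) ->
  (lanczos_Q M b0 k)^T *m b0 = vnorm b0 *: e1 R k.
Proof.
move=> bk; apply/matrixP => i j; rewrite ord1.
have -> : ((lanczos_Q M b0 k)^T *m b0) i 0 = dot (q i.+1) b0.
  by rewrite dotE mxE; apply: eq_bigr => l _; rewrite !mxE.
case: k i bk => [[]//|k] i bk.
have nb : vnorm b0 != 0 by have := bk 0%N isT.
have -> : dot (q i.+1) b0 = vnorm b0 * dot (q i.+1) (q 1).
  by rewrite dotZr mulrA divff // mul1r.
by rewrite (@lanczos_orthonormal k) ?mxE -1?ltnS.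
Qed.

(** Transposes appear because [<=] on matrices compares row spaces, while Krylov spaces are column
    spaces. *)
Lemma lanczos_q_sub (k j : nat) : (j <= k)%N ->
  ((q j)^T <= (lanczos_Q M b0 k)^T)%MS.
Proof.
case: j => [_|j jk]; first by rewrite trmx0 sub0mx.
rewrite -(col_lanczos_Q (Ordinal jk)) tr_col; exact: row_sub.
Qed.

Lemma lanczos_Q_sub (k : nat) :
  ((lanczos_Q M b0 k)^T <= (lanczos_Q M b0 k.+1)^T)%MS.
Proof.
apply/row_subP => j; rewrite -tr_col col_lanczos_Q.
exact/lanczos_q_sub/leqW/ltn_ord.
Qed.

Lemma lanczos_Q_mul_sub (k : nat) :
  ((M *m lanczos_Q M b0 k)^T <= (lanczos_Q M b0 k.+1)^T)%MS.
Proof.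
apply/row_subP => j; rewrite -tr_col colE -mulmxA -colE col_lanczos_Q.
have jk := ltn_ord j.
rewrite lanczos_recurrence !linearD !linearZ /= !addmx_sub // scalemx_sub //;
by apply: lanczos_q_sub; rewrite ?ltnS //; lia.
Qed.

Lemma lanczos_b0_sub (k : nat) : (b0^T <= (lanczos_Q M b0 k.+1)^T)%MS.
Proof.
have [->|nb] := eqVneq b0 0; first by rewrite trmx0 sub0mx.
have b0E : b0 = vnorm b0 *: q 1.
  by rewrite scalerA divff ?vnorm_eq0 // scale1r.
by rewrite [X in X^T]b0E linearZ /= scalemx_sub // lanczos_q_sub.
Qed.

End Lanczos.

(** Horner evaluation: each multiplication by [H] advances [Y] by one index, and [g] can be added at
    every positive index. *)
Lemma krylov_poly (R : realType) (p : nat) (H : 'M[R]_p.+1) (g : 'cV[R]_p.+1)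
    (Y : forall k, 'M[R]_(p.+1, k)) (k : nat) (r : {poly R}) :
  (forall k, ((H *m Y k)^T <= (Y k.+1)^T)%MS) ->
  (forall k, (g^T <= (Y k.+1)^T)%MS) ->
  (size r <= k)%N -> exists x, horner_mx H r *m g = Y k *m x.
Proof.
move=> HY gY; elim: k r => [|k IH] r rk.
  exists 0; move: rk; rewrite leqn0 size_poly_eq0 => /eqP ->.
  by rewrite rmorph0 mul0mx mulmx0.
elim/poly_ind: r rk => [_|r c _ rk].
  by exists 0; rewrite rmorph0 mul0mx mulmx0.
have [|x xE] := IH r.
  by move: rk; rewrite size_MXaddC; case: ifP => [/andP[/eqP-> _]|];
    rewrite ?size_poly0.
have : ((horner_mx H (r * 'X + c%:P) *m g)^T <= (Y k.+1)^T)%MS.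
  rewrite mulrC rmorphD rmorphM /= horner_mx_X horner_mx_C mulmxDl mul_scalar_mx.
  rewrite -mulmxA xE mulmxA linearD linearZ /= addmx_sub ?scalemx_sub // trmx_mul.
  exact: mulmx_sub.
case/submxP => D /(congr1 trmx); rewrite trmxK trmx_mul trmxK => ->.
by exists D^T.
Qed.

(** For the projector [P] onto the null space, this keeps the whole Lanczos process inside it. *)
Lemma lanczos_q_fixed (R : realType) (n : nat) (M P : 'M[R]_n)
    (b0 : 'cV[R]_n) (i : nat) :
  P *m M = M -> P *m b0 = b0 -> P *m lanczos_q M b0 i = lanczos_q M b0 i.
Proof.
move=> PM Pb; suff [] : P *m lanczos_q M b0 i = lanczos_q M b0 i /\
  P *m lanczos_q M b0 i.+1 = lanczos_q M b0 i.+1 by [].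
elim: i => [|i [IH1 IH2]]; first by rewrite mulmx0 /= -scalemxAr Pb.
split=> //; have [-> _] := lanczos_step_eq M b0 i.
by rewrite -scalemxAr !mulmxBr -!scalemxAr mulmxA PM IH1 IH2.
Qed.

Lemma lanczos_Q_fixed (R : realType) (n : nat) (M P : 'M[R]_n)
    (b0 : 'cV[R]_n) (k : nat) :
  P *m M = M -> P *m b0 = b0 -> P *m lanczos_Q M b0 k = lanczos_Q M b0 k.
Proof.
move=> PM Pb; apply/matrixP => i j.
have /matrixP/(_ i 0) := lanczos_q_fixed j.+1 PM Pb.
by rewrite !mxE => <-; apply: eq_bigr => l _; rewrite mxE.
Qed.

(** * Restriction to Krylov spaces *)

Section Lagrange.
Variable R : realType.

(** Common form of the constraints of LGopt, in coordinates of the null space, and of rLGopt. *)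
Definition lagrange_pair (p : nat) (H : 'M[R]_p) (g : 'cV[R]_p) (c lam : R)
  (y : 'cV[R]_p) : Prop := (H - lam%:M) *m y = - g /\ vnorm y = c.

Definition lagrange_min (p : nat) (H : 'M[R]_p) (g : 'cV[R]_p) (c lam : R)
  (y : 'cV[R]_p) : Prop :=
  lagrange_pair H g c lam y /\
  forall lam' y', lagrange_pair H g c lam' y' -> lam <= lam'.

Lemma dot_mulB (p : nat) (H : 'M[R]_p) (lam : R) (d e : 'cV[R]_p) :
  dot d ((H - lam%:M) *m e) = dot d (H *m e) - lam * dot d e.
Proof. by rewrite mulmxBl mul_scalar_mx !dot_lin. Qed.

(* A minimizer on the sphere has a multiplier that makes the shifted matrix
   positive semidefinite, and the least multiplier is no larger. *)
Lemma lagrange_min_psd (p : nat) (H : 'M[R]_p) (g : 'cV[R]_p) (c lam : R)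
    (y : 'cV[R]_p) : H^T = H -> 0 < c -> lagrange_min H g c lam y ->
  forall d, 0 <= dot d ((H - lam%:M) *m d).
Proof.
move=> sH c0 [[_ yc] lammin] d.
have [|y1 y1c y1min] := @sphere_min_exists R p H g (c ^+ 2) y.
  by rewrite -vnorm_sq yc.
have [|w|lam1 [e1 psd1]] := @sphere_min_multiplier R p H g y1 sH.
- by rewrite y1c exprn_gt0.
- by rewrite y1c; exact: y1min.
have : lam <= lam1.
  by apply: (lammin lam1 y1); split=> //; apply/vnorm_eqP => //; exact: ltW.
have := psd1 d; rewrite !dot_mulB; have := dot_ge0 d; nra.
Qed.

Lemma lagrange_min_quad (p : nat) (H : 'M[R]_p) (g : 'cV[R]_p) (c lam : R)
    (y w : 'cV[R]_p) : H^T = H -> 0 < c -> lagrange_min H g c lam y ->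
  vnorm w = c -> quad H g y <= quad H g w.
Proof.
move=> sH c0 lm wc; have psd := lagrange_min_psd sH c0 lm.
case: lm => [[ey yc] _]; rewrite -subr_ge0 (quad_diff sH ey) //.
by rewrite -!vnorm_sq wc yc.
Qed.

(** Stationarity paired with [y]. The error of a multiplier is thereby reduced to errors of the
    value and of the point. *)
Lemma lagrange_multiplier (p : nat) (H : 'M[R]_p) (g : 'cV[R]_p) (c lam : R)
    (y : 'cV[R]_p) : lagrange_pair H g c lam y ->
  c ^+ 2 * lam = quad H g y - dot g y.
Proof.
move=> [ey <-]; have := congr1 (dot y) ey.
rewrite dot_mulB dotNr vnorm_sq /quad (dotC g) => h; lra.
Qed.

Lemma quad_restrict (p q : nat) (H : 'M[R]_p) (g : 'cV[R]_p) (Y : 'M[R]_(p, q))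
    (x : 'cV[R]_q) : quad (Y^T *m H *m Y) (Y^T *m g) x = quad H g (Y *m x).
Proof.
by rewrite /quad (dot_mull Y) !mulmxA (dotC (Y^T *m g)) -(dot_mull Y) (dotC _ g).
Qed.

End Lagrange.

(** * Spectral bounds and polynomial approximation in Krylov spaces *)

Section SpectralBounds.
Variables (R : realType) (p : nat) (K : 'M[R]_p.+1) (a b : R).
Hypothesis sK : K^T = K.
Hypothesis eigK : forall t, eigenvalue K t -> a <= t <= b.

Lemma tr_horner_mx (q : {poly R}) : (horner_mx K q)^T = horner_mx K q.
Proof.
elim/poly_ind: q => [|q c IH]; first by rewrite rmorph0 trmx0.
rewrite [in RHS](mulrC q) !rmorphD !rmorphM /= horner_mx_X horner_mx_C linearD /=.
by rewrite tr_scalar_mx [(_ * _)^T]trmx_mul IH sK.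
Qed.

Lemma rayleigh_bounds (x : 'cV[R]_p.+1) :
  a * dot x x <= dot x (K *m x) <= b * dot x x.
Proof.
have [d [c [c0 ed sm]]] := spectral_measure x sK.
have := sm 1; rewrite rmorph1 mul1mx => ->.
have := sm 'X; rewrite horner_mx_X => ->.
rewrite !mulr_sumr; apply/andP; split; apply: ler_sum => i _;
  by rewrite hornerC hornerX mulr1 (mulrC (c i)) ler_wpM2r //; case/andP: (eigK (ed i)).
Qed.

(** By symmetry the squared norm is the spectral sum of [q * q], compared term by term with that of
    1. *)
Lemma horner_mx_norm_le (q : {poly R}) (del : R) (x : 'cV[R]_p.+1) :
  0 <= del -> (forall t, a <= t <= b -> `|q.[t]| <= del) ->
  vnorm (horner_mx K q *m x) <= del * vnorm x.
Proof.
move=> del0 qdel; apply: vnorm_le; first by rewrite mulr_ge0 ?vnorm_ge0.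
rewrite dot_mull tr_horner_mx mulmxA exprMn vnorm_sq.
have [d [c [c0 ed sm]]] := spectral_measure x sK.
have := sm (q * q); rewrite rmorphM => ->.
have := sm 1; rewrite rmorph1 mul1mx => ->.
rewrite mulr_sumr; apply: ler_sum => i _.
rewrite hornerC hornerM mulr1 (mulrC (c i)) ler_wpM2r // -expr2.
by rewrite -real_normK ?num_real // ler_pXn2r ?nnegrE //; exact/qdel/eigK.
Qed.

Lemma opnorm2_ge : 0 < a -> eigenvalue K b -> b <= opnorm2 K.
Proof.
move=> a0 eb; have /andP[ab _] := eigK eb.
have b0 : 0 <= b by exact: le_trans (ltW a0) ab.
have /eigenvalueP[v vK v0] := eb.
have Kv : K *m v^T = b *: v^T by rewrite -linearZ /= -vK trmx_mul sK.
have nv : vnorm v^T != 0 by rewrite vnorm_eq0 trmx_eq0.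
pose u := (vnorm v^T)^-1 *: v^T.
have nu : vnorm u = 1 by rewrite vnormZ ger0_norm ?invr_ge0 ?vnorm_ge0 // mulVf.
have -> : b = vnorm (K *m u).
  rewrite -scalemxAr Kv scalerA mulrC -scalerA -/u vnormZ nu mulr1 ger0_norm //.
apply: sup_upper_bound; last by exists u.
(* A supremum dominates its set only if the set is nonempty and bounded; [b] itself is an upper
   bound. *)
split; first by exists (vnorm (K *m u)), u.
exists b => _ [w /= nw <-].
rewrite -[leRHS]mulr1 -nw -[K in K *m w]horner_mx_X.
apply: horner_mx_norm_le => // t /andP[ta tb].
by rewrite hornerX ger0_norm // (le_trans (ltW a0)).
Qed.

(* y - r(K) K y = q(K) y with q(0) = 1 and K y = -g, where q is the Chebyshev
   polynomial of the spectral interval. *)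
Lemma krylov_approx (g y : 'cV[R]_p.+1) (Y : forall k, 'M[R]_(p.+1, k)) (k : nat) :
  (forall k, ((K *m Y k)^T <= (Y k.+1)^T)%MS) ->
  (forall k, (g^T <= (Y k.+1)^T)%MS) ->
  0 < a -> a <= b -> (0 < k)%N -> K *m y = - g ->
  let Gam := (Num.sqrt (b / a) + 1) / (Num.sqrt (b / a) - 1) in
  let D := Gam ^+ k + Gam ^- k in
  exists x, vnorm (Y k *m x - y) <= 2 * D^-1 * vnorm y.
Proof.
move=> KY gY a0 ab k0 Ky Gam D.
have [D0 [q [sq q0 qb]]] := chebyshev_shifted a0 ab k0.
have : root (1 - q) 0 by rewrite rootE !hornerE q0 subrr.
move=> /factor_theorem[r]; rewrite subr0 => rE.
(* Removing the root at 0 lowers the degree by one, which is what places the image of [g] in the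
   range of [Y k]. *)
have sr : (size r <= k)%N.
  have : (size (r * 'X)%R <= k.+1)%N.
    by rewrite -rE (leq_trans (size_polyD _ _)) // geq_max size_poly1 size_polyN.
  by have [->|r0] := eqVneq r 0; rewrite ?size_poly0 // size_mulX.
have [x xE] := krylov_poly KY gY sr.
exists (- x); rewrite mulmxN -xE.
have -> : - (horner_mx K r *m g) - y = - (horner_mx K q *m y).
  have -> : q = 1 - r * 'X by rewrite -rE opprB addrC subrK.
  rewrite rmorphB rmorphM rmorph1 /= horner_mx_X mulmxBl mul1mx -mulmxA Ky mulmxN.
  by rewrite opprK opprD addrC.
rewrite -scaleN1r vnormZ normrN1 mul1r.
by apply: horner_mx_norm_le => //; rewrite mulr_ge0.
Qed.

End SpectralBounds.

(** * Error bounds for the restricted minimizer *)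

Section RestrictedBounds.
Variables (R : realType) (p : nat) (H : 'M[R]_p.+1) (g y : 'cV[R]_p.+1).
Variables (a b c lam : R).
Hypothesis sH : H^T = H.
Local Notation K := (H - lam%:M).
Hypothesis eigK : forall t, eigenvalue K t -> a <= t <= b.
Hypotheses (a0 : 0 < a) (ab : a <= b) (c0 : 0 < c).
Hypothesis ly : lagrange_pair H g c lam y.

(** Rescaling [Y k *m w] to the sphere at most doubles its error, minimality of [x] allows the
    comparison, and the excess is a quadratic form bounded by the top eigenvalue. *)
Lemma restricted_min_bound (k : nat) (Y : 'M[R]_(p.+1, k)) (x w : 'cV[R]_k) (e : R) :
  Y^T *m Y = 1%:M -> vnorm x = c ->
  (forall w, vnorm w = c -> quad H g (Y *m x) <= quad H g (Y *m w)) ->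
  vnorm (Y *m w - y) <= e ->
  quad H g (Y *m x) - quad H g y <= b * (2 * e) ^+ 2.
Proof.
move=> YY xc xmin we; have [ey yc] := ly.
have e0 : 0 <= e := le_trans (vnorm_ge0 _) we.
have b0 : 0 <= b := le_trans (ltW a0) ab.
suff [w' w'c w'e] : exists2 w', vnorm w' = c & vnorm (Y *m w' - y) <= 2 * e.
  have := xmin _ w'c; rewrite -(lerD2r (- quad H g y)) => /le_trans; apply.
  rewrite (quad_diff sH ey); last by rewrite -!vnorm_sq vnorm_isom // w'c yc.
  have /andP[_] := rayleigh_bounds (symB_scalar lam sH) eigK (Y *m w' - y).
  move=> /le_trans; apply; rewrite ler_wpM2l // -vnorm_sq.
  by rewrite ler_pXn2r ?nnegrE ?vnorm_ge0 ?mulr_ge0.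
(* The zero vector cannot be rescaled; but then [c <= e], and any point of the sphere, such as [x],
   is within [2 * c] of [y]. *)
have [Yw0|Yw0] := eqVneq (Y *m w) 0.
  exists x => //; apply: le_trans (vnormD _ _) _.
  move: we; rewrite Yw0 sub0r -scaleN1r vnormZ normrN1 mul1r yc vnorm_isom // xc.
  lra.
exists ((vnorm y / vnorm (Y *m w)) *: w).
  rewrite vnormZ (vnorm_isom _ YY) yc ger0_norm ?divr_ge0 ?(ltW c0) ?vnorm_ge0 //.
  by rewrite divfK // -(vnorm_isom _ YY) vnorm_eq0.
rewrite -scalemxAr; apply: le_trans (rescale_dist _ Yw0) _.
by rewrite ler_wpM2l.
Qed.

Lemma restricted_dist_bound (z : 'cV[R]_p.+1) (e : R) : 0 <= e -> vnorm z = c ->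
  quad H g z - quad H g y <= b * e ^+ 2 -> vnorm (z - y) <= e * Num.sqrt (b / a).
Proof.
move=> e0 zc; have [ey yc] := ly.
rewrite (quad_diff sH ey); last by rewrite -!vnorm_sq zc yc.
have /andP[h _] := rayleigh_bounds (symB_scalar lam sH) eigK (z - y).
move=> /(le_trans h) {}h.
have b0 : 0 <= b := le_trans (ltW a0) ab.
apply: vnorm_le; first by rewrite mulr_ge0 ?sqrtr_ge0.
rewrite exprMn sqr_sqrtr ?divr_ge0 ?(ltW a0) // mulrA ler_pdivlMr // mulrC.
by rewrite [leRHS]mulrC.
Qed.

(** Subtraction of the two multiplier identities, with Cauchy-Schwarz on the linear term. *)
Lemma multiplier_bound (z : 'cV[R]_p.+1) (mu d1 d2 : R) :
  c ^+ 2 * mu = quad H g z - dot g z ->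
  0 <= quad H g z - quad H g y <= d1 -> vnorm (z - y) <= d2 ->
  `|mu - lam| <= d1 / c ^+ 2 + vnorm g * d2 / c ^+ 2.
Proof.
move=> muE /andP[q0 qd1] zd2.
have lamE := lagrange_multiplier ly.
have cs := cauchy_schwarz g (z - y).
have gd : `|dot g (z - y)| <= vnorm g * d2.
  by apply: le_trans cs _; rewrite ler_wpM2l ?vnorm_ge0.
rewrite -mulrDl ler_pdivlMr ?exprn_gt0 //.
have -> : `|mu - lam| * c ^+ 2 = `|(quad H g z - quad H g y) - dot g (z - y)|.
  rewrite -[c ^+ 2 in LHS]ger0_norm ?sqr_ge0 // -normrM; congr `| _ |.
  rewrite mulrC mulrBr muE lamE !dot_lin; ring.
by apply: le_trans (ler_normB _ _) _; rewrite lerD // ger0_norm.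
Qed.

End RestrictedBounds.

(** * Reduction to the null space of the constraint *)

Lemma mul_outer (R : realType) (n : nat) (a b c : 'cV[R]_n) :
  a *m b^T *m c = dot b c *: a.
Proof. by rewrite -mulmxA [b^T *m c]mx11_scalar mul_mx_scalar dot.unlock. Qed.

Section Reduction.
Variables (R : realType) (n m p : nat).
Variables (A : 'M[R]_n) (C : 'M[R]_(n, m)) (b : 'cV[R]_m) (S1 : 'M[R]_(n, p)).
Hypotheses (sA : A^T = A) (rC : \rank C = m) (n0_lt1 : vnorm (n0v C b) < 1).
Hypotheses (SS : S1^T *m S1 = 1%:M) (CS : C^T *m S1 = 0).
Hypothesis kerS : forall y : 'cV[R]_n, C^T *m y = 0 -> exists z, y = S1 *m z.

Local Notation n0 := (n0v C b).
Local Notation H := (S1^T *m A *m S1).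
Local Notation g := (S1^T *m A *m n0).
Local Notation gamma := (gammav C b).
Local Notation M := (PAP A C).
Local Notation b0 := (b0v A C b).

Lemma reduced_sym : H^T = H.
Proof. by rewrite !trmx_mul trmxK sA mulmxA. Qed.

Lemma gram_unit : C^T *m C \in unitmx.
Proof.
rewrite -row_free_unit -kermx_eq0; apply/rowV0P => v /sub_kermxP vCC.
have : dot (C *m v^T) (C *m v^T) = 0.
  by rewrite dot.unlock !trmx_mul trmxK -mulmxA (mulmxA C^T) mulmxA vCC mul0mx mxE.
move/eqP; rewrite dot_eq0 => /eqP Cv; apply/eqP; rewrite -trmx_eq0.
have fC : row_free C^T by rewrite /row_free mxrank_tr rC.
have : v *m C^T = 0 by rewrite -[LHS]trmxK trmx_mul trmxK Cv trmx0.
by rewrite -(mul0mx _ C^T) => /(row_free_inj fC) ->; rewrite trmx0.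
Qed.

Lemma mul_tr_n0 : C^T *m n0 = b.
Proof. by rewrite /n0v !mulmxA mulmxV ?gram_unit // mul1mx. Qed.

Lemma S1_tr_C : S1^T *m C = 0.
Proof. by rewrite -[LHS]trmxK trmx_mul trmxK CS trmx0. Qed.

Lemma S1_tr_n0 : S1^T *m n0 = 0.
Proof. by rewrite /n0v !mulmxA S1_tr_C !mul0mx. Qed.

Lemma PprojE : Pproj C = S1 *m S1^T.
Proof.
have uC := gram_unit.
have CP : C^T *m Pproj C = 0.
  by rewrite /Pproj mulmxBr mulmx1 !mulmxA mulmxV // mul1mx subrr.
have PS : Pproj C *m S1 = S1.
  by rewrite /Pproj mulmxBl mul1mx -!mulmxA CS !mulmx0 subr0.
have sP : (Pproj C)^T = Pproj C.
  rewrite /Pproj linearB /= trmx1 !trmx_mul trmxK trmx_inv trmx_mul trmxK.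
  by rewrite mulmxA.
(* Each column of the projector lies in the null space, hence is reproduced by [S1 *m S1^T];
   transposing [PS] then finishes. *)
have PE : Pproj C = S1 *m (S1^T *m Pproj C).
  apply/matrixP => i j.
  have [|z zE] := kerS (y := col j (Pproj C)).
    by rewrite colE mulmxA CP mul0mx.
  have : col j (Pproj C) = col j (S1 *m (S1^T *m Pproj C)).
    rewrite [RHS]colE -!mulmxA -colE zE; congr (_ *m _).
    by rewrite mulmxA SS mul1mx.
  by move/matrixP/(_ i 0); rewrite mxE [RHS]mxE.
by rewrite PE -[S1^T *m _]trmxK trmx_mul trmxK sP PS.
Qed.

Lemma PAPE : M = S1 *m H *m S1^T.
Proof. by rewrite /PAP PprojE !mulmxA. Qed.

Lemma PAP_sym : M^T = M.
Proof. by rewrite PAPE !trmx_mul !trmxK sA !mulmxA. Qed.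

Lemma PAP_S1 : M *m S1 = S1 *m H.
Proof. by rewrite PAPE -!mulmxA SS mulmx1. Qed.

Lemma S1_tr_PAP : S1^T *m M = H *m S1^T.
Proof. by rewrite PAPE !mulmxA SS mul1mx. Qed.

Lemma b0E : b0 = S1 *m g.
Proof. by rewrite /b0v PprojE !mulmxA. Qed.

Lemma S1_tr_b0 : S1^T *m b0 = g.
Proof. by rewrite b0E mulmxA SS mul1mx. Qed.

Lemma n0_sq_lt1 : 0 < 1 - vnorm n0 ^+ 2.
Proof. by rewrite subr_gt0 expr_lt1 ?vnorm_ge0 //. Qed.

Lemma gamma_gt0 : 0 < gamma.
Proof. by rewrite /gammav sqrtr_gt0 n0_sq_lt1. Qed.

Lemma gamma_sq : gamma ^+ 2 = 1 - dot n0 n0.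
Proof. by rewrite /gammav sqr_sqrtr ?vnorm_sq // -vnorm_sq ltW // n0_sq_lt1. Qed.

Lemma shifted_S1 (lam : R) (y : 'cV[R]_p) :
  (M - lam%:M) *m (S1 *m y) = S1 *m ((H - lam%:M) *m y).
Proof.
by rewrite !mulmxBl !mul_scalar_mx mulmxBr !mulmxA PAP_S1 -scalemxAr !mulmxA.
Qed.

Lemma S1_inj (y z : 'cV[R]_p) : S1 *m y = S1 *m z -> y = z.
Proof. by move/(congr1 (mulmx S1^T)); rewrite !mulmxA SS !mul1mx. Qed.

Lemma LG_feasibleP (lam : R) (u : 'cV[R]_n) :
  LG_feasible A C b lam u <->
  exists2 y, u = S1 *m y & lagrange_pair H g gamma lam y.
Proof.
split=> [[eu [nu Cu]]|[y -> [ey ny]]]; last first.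
  split; first by rewrite shifted_S1 ey mulmxN b0E.
  by rewrite vnorm_isom // mulmxA CS mul0mx.
have [y uE] := kerS Cu; exists y => //; split; last by rewrite -nu uE vnorm_isom.
by apply: S1_inj; rewrite -shifted_S1 -uE eu b0E mulmxN.
Qed.

Lemma LG_minimizer_reduced (lam : R) (u : 'cV[R]_n) : LG_minimizer A C b lam u ->
  exists2 y, u = S1 *m y & lagrange_min H g gamma lam y.
Proof.
case=> /LG_feasibleP[y uE ly] lmin; exists y => //; split=> // lam' y' ly'.
by apply: (lmin lam' (S1 *m y')); apply/LG_feasibleP; exists y'.
Qed.

(** Pythagoras: [n0] is orthogonal to the range of [S1], so the unit sphere cuts out the radius
    [gamma]. *)
Lemma CRQ_feasibleP (v : 'cV[R]_n) :
  CRQ_feasible C b v <-> exists2 w, v = n0 + S1 *m w & vnorm w = gamma.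
Proof.
have sq w : dot (n0 + S1 *m w) (n0 + S1 *m w) = dot n0 n0 + dot w w.
  rewrite !dot_lin dot_isom // (dotC n0) !dot_mull S1_tr_n0 dot0r; ring.
have vv (z : 'cV[R]_n) : z^T *m z = 1%:M <-> dot z z = 1.
  rewrite dot.unlock; split=> [->|e]; first by rewrite mxE.
  by rewrite [LHS]mx11_scalar e.
split=> [[/vv v1 Cv]|[w -> wg]]; last first.
  split; last by rewrite mulmxDr mul_tr_n0 mulmxA CS mul0mx addr0.
  by apply/vv; rewrite sq -(vnorm_sq w) wg gamma_sq addrC subrK.
have [|w wE] := kerS (y := v - n0); first by rewrite mulmxBr Cv mul_tr_n0 subrr.
have vE : v = n0 + S1 *m w by rewrite -wE addrC subrK.
exists w => //; apply/vnorm_eqP; first exact: ltW gamma_gt0.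
rewrite gamma_sq -v1 vE sq; ring.
Qed.

Lemma hq_reduced (w : 'cV[R]_p) : hq A (n0 + S1 *m w) = hq A n0 + quad H g w.
Proof.
have hqE (z : 'cV[R]_n) : hq A z = dot z (A *m z).
  by rewrite /hq dot.unlock mulmxA.
rewrite !hqE /quad mulmxDr !dot_lin (dot_sym n0 (S1 *m w) sA).
rewrite (dotC g w) !(dot_mull S1) !mulmxA; ring.
Qed.

(** Semidefiniteness gives [lam <= t]. Equality would make an eigenvector for [lam] a minimizer of
    QEPmin orthogonal to [b0], which is the hard case. *)
Lemma easy_case_gap (lam : R) (u : 'cV[R]_n) (t : R) :
  QEP_easy_case A C b -> LG_minimizer A C b lam u -> eigenvalue H t -> lam < t.
Proof.
move=> easy /LG_minimizer_reduced[y _ ly] /eigenvalueP[v vH v0].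
have psd := lagrange_min_psd reduced_sym gamma_gt0 ly.
have [[ey ny] lmin] := ly.
pose z := v^T; have z0 : z != 0 by rewrite trmx_eq0.
have Hz : H *m z = t *: z by rewrite /z -linearZ /= -vH trmx_mul reduced_sym.
have zz : 0 < dot z z by rewrite lt_def dot_eq0 z0 dot_ge0.
rewrite lt_neqAle; apply/andP; split; last first.
  by have := psd z; rewrite dot_mulB Hz dotZr -mulrBl pmulr_lge0 // subr_ge0.
apply/eqP => lamt; apply: easy; exists lam, (S1 *m z).
have Kz : (H - lam%:M) *m z = 0 by rewrite mulmxBl mul_scalar_mx Hz lamt subrr.
(* [g] lies in the range of a symmetric matrix whose kernel contains [z]. *)
have gz : dot g z = 0.
  have -> : g = - ((H - lam%:M) *m y) by rewrite ey opprK.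
  by rewrite dotNl dot_mull (symB_scalar _ reduced_sym) Kz dot0r oppr0.
have b0z : dot b0 (S1 *m z) = 0 by rewrite b0E dot_isom.
split; last first.
  by apply/matrixP => i j; rewrite !ord1 [RHS]mxE -b0z dot.unlock.
split.
  split; first by apply: contra_neq z0 => Sz0; apply: S1_inj; rewrite Sz0 mulmx0.
  split; first by rewrite mulmxA CS mul0mx.
  by rewrite -mulmxA shifted_S1 Kz !mulmx0 mul_outer b0z scale0r scaler0.
(* A QEPmin-feasible value below [lam] is turned into an LGopt-feasible one, contradicting
   minimality of [lam]. *)
move=> lam' z' [z'0 [/kerS[w z'E]]]; rewrite {z'}z'E in z'0 *.
have w0 : w != 0 by apply: contra_neq z'0 => ->; rewrite mulmx0.
rewrite mul_outer -mulmxA !shifted_S1 b0E dot_isom // => e.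
rewrite leNgt; apply/negP => lt.
set K := H - lam'%:M in e.
have KKw : K *m (K *m w) = gamma ^- 2 *: (dot g w *: g).
  by apply: S1_inj; rewrite e -!scalemxAr.
have sK : K^T = K by exact: symB_scalar reduced_sym.
have ww : 0 < dot w w by rewrite lt_def dot_eq0 w0 dot_ge0.
have KwKw : dot (K *m w) (K *m w) = gamma ^- 2 * dot g w ^+ 2.
  by rewrite dot_mull sK KKw !dotZr (dotC w) expr2.
(* Otherwise [K *m w = 0], so [lam'] would be an eigenvalue of [H] below [lam], against
   semidefiniteness. *)
have gw0 : dot g w != 0.
  apply: contraTneq ww => gw; rewrite -leNgt.
  move: KwKw; rewrite gw expr0n mulr0 => /eqP; rewrite dot_eq0 => /eqP Kw.
  have := psd w; rewrite dot_mulB.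
  have : dot w (K *m w) = 0 by rewrite Kw dot0r.
  rewrite dot_mulB; nra.
have g0 : gamma != 0 by rewrite gt_eqF // gamma_gt0.
(* The scalar is fixed by the equation for [KKw]; [KwKw] then gives norm [gamma]. *)
suff /lmin : lagrange_pair H g gamma lam' ((- (gamma ^+ 2 / dot g w)) *: (K *m w)).
  by rewrite leNgt lt.
split.
  rewrite -scalemxAr KKw !scalerA -[RHS]scaleN1r.
  apply: (congr1 (fun a => a *: g)); field.
  by rewrite g0 gw0.
apply/vnorm_eqP; first exact: ltW gamma_gt0.
by rewrite dotZl dotZr KwKw; field; rewrite g0 gw0.
Qed.

End Reduction.

(** * Monotonicity and convergence rate of the Lanczos iterates *)

Lemma eigenvalueB (R : realType) (p : nat) (H : 'M[R]_p) (lam t : R) :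
  eigenvalue (H - lam%:M) t = eigenvalue H (t + lam).
Proof.
apply/eigenvalueP/eigenvalueP => -[v vH v0]; exists v => //; move: vH;
  rewrite mulmxBr mul_mx_scalar.
  by move/eqP; rewrite subr_eq -scalerDl => /eqP.
by move=> ->; rewrite -scalerBl addrK.
Qed.

Theorem theorem4p2 (R : realType) (n m : nat)
  (A : 'M[R]_n) (C : 'M[R]_(n, m)) (b : 'cV[R]_m)
  (S1 : 'M[R]_(n, n - m))
  (vstar : 'cV[R]_n) (lamstar : R) (ustar : 'cV[R]_n)
  (thmin thmax : R) (kmax : nat)
  (mu : nat -> R) (x : forall k : nat, 'cV[R]_k) :
  (* standing assumptions *)
  A^T = A ->
  (m < n)%N ->
  \rank C = m ->
  vnorm (n0v C b) < 1 ->
  b0v A C b != 0 ->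
  (* S1 has orthonormal columns spanning N(C^T) *)
  S1^T *m S1 = 1%:M ->
  C^T *m S1 = 0 ->
  (forall y : 'cV[R]_n, C^T *m y = 0 -> exists z, y = S1 *m z) ->
  (* easy case *)
  QEP_easy_case A C b ->
  CRQ_minimizer A C b vstar ->
  LG_minimizer A C b lamstar ustar ->
  (* smallest / largest eigenvalues of H = S1^T A S1 *)
  let H := S1^T *m A *m S1 in
  eigenvalue H thmin -> (forall t, eigenvalue H t -> thmin <= t) ->
  eigenvalue H thmax -> (forall t, eigenvalue H t -> t <= thmax) ->
  (* k_max: smallest k with beta_{k+1} = 0 *)
  let M := PAP A C in
  let b0 := b0v A C b in
  lanczos_beta M b0 kmax.+1 = 0 ->
  (forall k, (k < kmax)%N -> lanczos_beta M b0 k.+1 != 0) ->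
  (* (mu^(k), x^(k)) minimizer of rLGopt *)
  (forall k, (1 <= k <= kmax)%N -> rLG_minimizer A C b k (mu k) (x k)) ->
  let v := fun k => n0v C b + lanczos_Q M b0 k *m x k in
  let gamma := gammav C b in
  let kappa := (thmax - lamstar) / (thmin - lamstar) in
  let Gam := (Num.sqrt kappa + 1) / (Num.sqrt kappa - 1) in
  let nrm := opnorm2 (H - lamstar%:M) in
  (* (a) *)
  (forall k, (1 <= k)%N -> (k < kmax)%N -> hq A (v k.+1) <= hq A (v k)) /\
  (* (b) *)
  (forall k, (1 <= k <= kmax)%N ->
     let D := Gam ^+ k + Gam ^- k in
     0 <= hq A (v k) - hq A vstar /\
     hq A (v k) - hq A vstar <= 16 * gamma ^+ 2 * nrm * D ^- 2 /\
     vnorm (v k - vstar) <= 4 * gamma * Num.sqrt kappa * D^-1 /\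
     `|mu k - lamstar| <= 16 * nrm * D ^- 2
                          + 4 / gamma * vnorm b0 * Num.sqrt kappa * D^-1).
Proof.
(* The dimension becomes a variable to be split: polynomials in a matrix need a successor size, and
   in dimension 0 there is no eigenvector. *)
have [p pE] : exists p, (n - m)%N = p by exists (n - m)%N.
move: S1; rewrite pE => {pE} S1.
move=> sA mn rC n0_lt1 b0_neq0 SS CS kerS easy vopt lgopt H.
case: p S1 SS CS kerS @H => [|p] S1 SS CS kerS H.
  by move=> /eigenvalueP[w _ /eqP[]]; apply/matrixP => i [].
move=> eig_min thmin_le eig_max thmax_ge M b0 beta0 beta_neq0 rlgopt.
move=> v gamma kappa Gam nrm.
pose g := S1^T *m A *m n0v C b.
have sH : H^T = H := reduced_sym S1 sA.
have gam0 : 0 < gamma := gamma_gt0 n0_lt1.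
have [y _ ymin] := LG_minimizer_reduced rC SS CS kerS lgopt.
have ly := ymin.1; have [ey yc] := ly.
set K := H - lamstar%:M in nrm ey *.
pose lo := thmin - lamstar; pose hi := thmax - lamstar.
have lo0 : 0 < lo.
  by rewrite subr_gt0; exact: (easy_case_gap sA rC n0_lt1 SS CS kerS easy lgopt eig_min).
have lohi : lo <= hi by rewrite lerD2r thmin_le.
have eigK t : eigenvalue K t -> lo <= t <= hi.
  by rewrite eigenvalueB => et; rewrite lerBlDr lerBrDr thmin_le ?thmax_ge.
have sK : K^T = K := symB_scalar _ sH.
have hi_nrm : hi <= nrm.
  by apply: (opnorm2_ge sK eigK lo0); rewrite eigenvalueB subrK.
have hi0 : 0 <= hi := le_trans (ltW lo0) lohi.
(* Uniqueness by definiteness: the excess of [w] over [y] is at least [lo] times their squared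
   distance, and at most 0. *)
have vstarE : vstar = n0v C b + S1 *m y.
  have [/(CRQ_feasibleP rC n0_lt1 SS CS kerS)[w -> wc] vmin] := vopt.
  congr (_ + _ *m _); apply/eqP; rewrite -subr_eq0 -dot_eq0.
  have : hq A (n0v C b + S1 *m w) <= hq A (n0v C b + S1 *m y).
    by apply: vmin; apply/(CRQ_feasibleP rC n0_lt1 SS CS kerS); exists y.
  rewrite !hq_reduced //.
  rewrite lerD2l -subr_le0 (quad_diff sH ey); last by rewrite -!vnorm_sq wc yc.
  have /andP[h _] := rayleigh_bounds sK eigK (w - y).
  move=> /(le_trans h); rewrite pmulr_rle0 // => h0.
  by rewrite eq_le h0 dot_ge0.
(* [Y k] holds the coordinates of the Lanczos vectors in the basis [S1]. *)
pose Q k := lanczos_Q M b0 k; pose Y k := S1^T *m Q k.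
have sM : M^T = M by exact: (PAP_sym sA rC SS CS kerS).
have beta_k k : (k <= kmax)%N -> forall i, (i < k)%N -> lanczos_beta M b0 i.+1 != 0.
  by move=> kk i ik; apply: beta_neq0; exact: leq_trans ik kk.
have QQ k : (k <= kmax)%N -> (Q k)^T *m Q k = 1%:M.
  by move=> kk; apply: lanczos_Q_isom => //; exact: beta_k.
have SY k : S1 *m Y k = Q k.
  rewrite mulmxA; apply: lanczos_Q_fixed.
    by rewrite /M (PAPE A rC SS CS kerS) !mulmxA -(mulmxA S1) SS mulmx1.
  by rewrite /b0 (b0E A b rC SS CS kerS) mulmxA -(mulmxA S1) SS mulmx1.
have Ysub k : ((Y k)^T <= (Y k.+1)^T)%MS.
  by rewrite !trmx_mul submxMr // lanczos_Q_sub.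
have YY k : (k <= kmax)%N -> (Y k)^T *m Y k = 1%:M.
  by move=> kk; rewrite trmx_mul trmxK -mulmxA SY QQ.
have TE k : lanczos_T M b0 k = (Y k)^T *m H *m Y k.
  rewrite /lanczos_T -/(Q k) /M (PAPE A rC SS CS kerS) trmx_mul trmxK !mulmxA //.
have gE k : (k <= kmax)%N -> vnorm b0 *: e1 R k = (Y k)^T *m g.
  move=> kk; rewrite -(lanczos_Q_b0 sM (beta_k k kk)) -/(Q k) -{1}SY trmx_mul -mulmxA.
  by rewrite /b0 (S1_tr_b0 A b rC SS CS kerS).
have xmin k : (1 <= k <= kmax)%N ->
    lagrange_min ((Y k)^T *m H *m Y k) ((Y k)^T *m g) gamma (mu k) (x k).
  move=> /[dup] kk /andP[_ kk2]; rewrite -TE -gE //; exact: rlgopt.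
have sT k : ((Y k)^T *m H *m Y k)^T = (Y k)^T *m H *m Y k.
  by rewrite trmx_mul [((Y k)^T *m H)^T]trmx_mul trmxK sH mulmxA.
have Yxmin k w : (1 <= k <= kmax)%N -> vnorm w = gamma ->
    quad H g (Y k *m x k) <= quad H g (Y k *m w).
  move=> kk wc; rewrite -!quad_restrict.
  exact: lagrange_min_quad (sT k) gam0 (xmin k kk) wc.
have vE k : v k = n0v C b + S1 *m (Y k *m x k) by rewrite mulmxA SY.
have xc k : (1 <= k <= kmax)%N -> vnorm (x k) = gamma.
  by move=> kk; have [[]] := xmin k kk.
split=> [k k1 kk|k /[dup] kk /andP[k1 kk2] D].
  rewrite !vE !hq_reduced // lerD2l.
  (* The Krylov spaces are nested, so the old iterate is a competitor of the same norm in the next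
     problem. *)
  have /submxP[E QE] := lanczos_Q_sub M b0 k.
  have {}QE : Q k = Q k.+1 *m E^T by rewrite -[LHS]trmxK QE trmx_mul trmxK.
  have -> : Y k *m x k = Y k.+1 *m (E^T *m x k) by rewrite /Y QE !mulmxA.
  apply: Yxmin => //.
  rewrite -(vnorm_isom _ (QQ k.+1 kk)) mulmxA -QE vnorm_isom ?QQ ?(ltnW kk) //.
  by rewrite xc // k1 ltnW.
have [D0 _] := chebyshev_shifted lo0 lohi k1; rewrite -/kappa -/Gam -/D in D0.
have zc : vnorm (Y k *m x k) = gamma by rewrite vnorm_isom ?YY // xc.
have [w wD] : exists w, vnorm (Y k *m w - y) <= 2 * D^-1 * gamma.
  rewrite /gamma -yc; apply: (krylov_approx sK eigK _ _ lo0 lohi k1 ey) => j.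
  (* Shifting the matrix by a scalar does not change its Krylov spaces. *)
  - rewrite mulmxBl mul_scalar_mx linearB linearZ /= -scaleNr addmx_sub ?scalemx_sub //.
    have -> : H *m Y j = S1^T *m (M *m Q j).
      by rewrite [RHS]mulmxA [S1^T *m M](S1_tr_PAP A rC SS CS kerS) -mulmxA.
    by rewrite !(trmx_mul S1^T) submxMr // lanczos_Q_mul_sub.
  - rewrite /g -(S1_tr_b0 A b rC SS CS kerS) !(trmx_mul S1^T) submxMr //.
    exact: lanczos_b0_sub.
(* One factor 2 comes from the Chebyshev bound, the other from rescaling; their product is the 4,
   and its square the 16, of the estimates. *)
have e0 : 0 <= 2 * (2 * D^-1 * gamma) by rewrite !mulr_ge0 // ltW.
have qd := restricted_min_bound sH eigK lo0 lohi gam0 ly (YY k kk2) (xc k kk)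
  (fun w => Yxmin k w kk) wD.
have zd := restricted_dist_bound sH eigK lo0 lohi ly e0 zc qd.
have q0 : 0 <= quad H g (Y k *m x k) - quad H g y.
  by rewrite subr_ge0; exact: lagrange_min_quad sH gam0 ymin zc.
have hdiff : hq A (v k) - hq A vstar = quad H g (Y k *m x k) - quad H g y.
  by rewrite vE vstarE !hq_reduced //; ring.
have qd' : quad H g (Y k *m x k) - quad H g y <= 16 * gamma ^+ 2 * nrm * D ^- 2.
  apply: le_trans qd _; rewrite -exprVn.
  have -> : hi * (2 * (2 * D^-1 * gamma)) ^+ 2 = hi * (16 * gamma ^+ 2 * D^-1 ^+ 2).
    by ring.
  have -> : 16 * gamma ^+ 2 * nrm * D^-1 ^+ 2 = nrm * (16 * gamma ^+ 2 * D^-1 ^+ 2).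
    by ring.
  by apply: ler_wpM2r => //; apply: mulr_ge0; [apply: mulr_ge0|]; rewrite ?sqr_ge0 ?ler0n.
have zd' : vnorm (Y k *m x k - y) <= 4 * gamma * Num.sqrt kappa * D^-1.
  apply: le_trans zd _; have -> : Num.sqrt (hi / lo) = Num.sqrt kappa by [].
  rewrite le_eqVlt; apply/orP; left; apply/eqP; ring.
rewrite hdiff; split=> //; split=> //; split.
  have -> : v k - vstar = S1 *m (Y k *m x k - y).
    by rewrite vE vstarE mulmxBr opprD addrACA subrr add0r.
  by rewrite vnorm_isom.
have muE : gamma ^+ 2 * mu k = quad H g (Y k *m x k) - dot g (Y k *m x k).
  by rewrite (lagrange_multiplier (xmin k kk).1) quad_restrict dot_mull trmxK.
have qq : 0 <= quad H g (Y k *m x k) - quad H g y <= 16 * gamma ^+ 2 * nrm * D ^- 2.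
  by rewrite q0.
apply: le_trans (multiplier_bound gam0 ly muE qq zd') _.
have -> : vnorm g = vnorm b0.
  by rewrite /b0 (b0E A b rC SS CS kerS) vnorm_isom.
have gn : gamma != 0 by rewrite gt_eqF.
(* [D] may be 0 when [kappa = 1]; as a variable, its inverse is no denominator for [field]. *)
rewrite -exprVn; move: (D^-1) => E.
by rewrite le_eqVlt; apply/orP; left; apply/eqP; field.
Qed.
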